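(* Let $k\ge 2$ and let $n$ be a positive multiple of $k$. Let $v_1,\ldots,v_{2n}$ be points in convex position labeled in clockwise order, partitioned into the $2n/k$ blocks $B_i=\{v_{(i-1)k+1},\ldots,v_{ik}\}$, and colored with colors $c_1,\ldots,c_k$ so that $v_{(i-1)k+r}$ ($1\le r\le k$) gets color $c_r$ if $i$ is odd and $c_{k+1-r}$ if $i$ is even. A plane perfect matching $M$ on $v_1,\ldots,v_{2n}$ is a $k$-colored matching if and only if $M$ has a valid block structure and $M$ contains no edge $v_sv_e$ ($s<e$) with the following four properties: (i) $v_s$ and $v_e$ lie in different blocks, say $v_s\in S$ and $v_e\in E$; (ii) there is no edge of $M$ joining two vertices of different colors with both endpoints among $v_{s+1},\ldots,v_{e-1}$; (iii) the number of blocks strictly between $S$ and $E$ is odd; (iv) if $v_s$ is the $j$-th vertex of $S$ (in increasing index order), then $v_e$ is the $(j+1)$-st vertex of $E$.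
   Context: A plane perfect matching on points in convex position is a set of pairwise non-crossing straight-line segments between the points such that each point is an endpoint of exactly one segment. Each edge $v_av_b$ with $a<b$ is regarded as directed from $v_a$ to $v_b$; $v_a$ has outdegree $1$ and $v_b$ has outdegree $0$. The matching has a valid block structure if within every block, no vertex of outdegree $1$ has smaller index than a vertex of outdegree $0$ (i.e. the outdegrees within each block read $0,\ldots,0,1,\ldots,1$ in index order). A $k$-colored matching is a plane perfect matching in which every edge joins two vertices of the same color. *)

(* Defs.v *)
From HB Require Import structures.
From mathcomp Require Import all_boot all_order all_algebra reals.
Set Implicit Arguments.
Unset Strict Implicit.
Unset Printing Implicit Defensive.
Import Order.TTheory GRing.Theory Num.Theory.

(* Indices are 0-based: v a, for a : 'I_N, is the point usually written
   v_{a+1}; likewise the block numbers, the positions inside a block and the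
   colors below are the usual ones minus 1. *)

Section Geometry.
Local Open Scope ring_scope.
Variables (R : realType) (N : nat).
Implicit Types (p q r x : 'rV[R]_2) (v : 'I_N -> 'rV[R]_2).

Definition convex_position v : Prop :=
  forall (i : 'I_N) (w : 'I_N -> R),
    (forall j, 0 <= w j) -> w i = 0 -> \sum_j w j = 1 ->
    v i <> \sum_j w j *: v j.

(* Twice the signed area of the triangle p q r, negative iff p, q, r are met
   in clockwise order. *)
Definition orient p q r : R :=
  (q 0 0 - p 0 0) * (r 0 1 - p 0 1) - (q 0 1 - p 0 1) * (r 0 0 - p 0 0).

Definition clockwise v : Prop :=
  forall i j l : 'I_N, (i < j)%N -> (j < l)%N -> orient (v i) (v j) (v l) < 0.

Definition in_open_segment p q x : Prop :=
  exists t : R, [/\ 0 < t, t < 1 & x = (1 - t) *: p + t *: q].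

Definition segments_cross p q p' q' : Prop :=
  exists x, in_open_segment p q x /\ in_open_segment p' q' x.

(* The edge joining v a and v b is represented by [set a; b]. *)
Definition perfect_matching (M : {set {set 'I_N}}) : Prop :=
  (forall e, e \in M -> #|e| = 2%N) /\
  (forall a : 'I_N, #|[set e in M | a \in e]| = 1%N).

Definition plane v (M : {set {set 'I_N}}) : Prop :=
  forall a b c d : 'I_N,
    [set a; b] \in M -> [set c; d] \in M -> [set a; b] <> [set c; d] ->
    ~ segments_cross (v a) (v b) (v c) (v d).

Definition plane_perfect_matching v M : Prop :=
  perfect_matching M /\ plane v M.

End Geometry.

Section Blocks.
Variables (k N : nat).
Implicit Types (M : {set {set 'I_N}}) (a b s e : 'I_N).

Definition block (a : nat) : nat := a %/ k.

Definition pos (a : nat) : nat := a %% k.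

(* The parity is reversed because block numbers start at 0. *)
Definition color (a : nat) : nat :=
  if odd (block a) then k.-1 - pos a else pos a.

Definition colored_matching M : Prop :=
  forall a b, [set a; b] \in M -> color a = color b.

Definition outdegree M a : nat :=
  #|[set b : 'I_N | (a < b) && ([set a; b] \in M)]|.

Definition valid_block_structure M : Prop :=
  forall a b, block a = block b ->
    outdegree M a = 1 -> outdegree M b = 0 -> ~ (a < b).

Definition blocks_between a b : nat :=
  #|[set i : 'I_(N %/ k) | block a < i < block b]|.

Definition forbidden_edge M s e : Prop :=
  [/\ block s <> block e,
      ~ (exists a b, [/\ [set a; b] \in M, color a <> color b,
                         s < a < e & s < b < e]),
      odd (blocks_between s e)
    & pos e = (pos s).+1].

End Blocks.

(* Main.v *)
Require Import Defs.
From mathcomp Require Import all_boot all_order all_algebra reals.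
From mathcomp Require Import zify ring lra.

(** Points in clockwise order turn "plane" into the combinatorial condition that
no two edges [a b], [c d] satisfy [a < c < b < d].  For the converse direction,
take a bichromatic edge [s e] with [e - s] minimal: the vertices strictly
between [s] and [e] are matched among themselves within their colors, so every
color occurs there an even number of times.  The parities of the [k] color
counts determine the position of [e] in its block from that of [s]: the mirror
image if the blocks of [s] and [e] have opposite parity (then [s] and [e] would
have the same color), and the next position otherwise. *)

Set Implicit Arguments.
Unset Strict Implicit.
Unset Printing Implicit Defensive.
Import Order.TTheory GRing.Theory Num.Theory.

(** * Plane geometry: signed areas and crossing segments *)

Section Crossing.
Local Open Scope ring_scope.
Variables (R : realType) (N : nat) (v : 'I_N -> 'rV[R]_2).

Lemma segments_cross_orient (p q p' q' : 'rV[R]_2) :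
  0 < orient p q p' -> orient p q q' < 0 ->
  orient p' q' p < 0 -> 0 < orient p' q' q ->
  segments_cross p q p' q'.
Proof.
set o1 := orient p q p'; set o2 := orient p q q'.
set o3 := orient p' q' p; set o4 := orient p' q' q => h1 h2 h3 h4.
have d_gt0 : 0 < o1 - o2 by lra.
have eq_d : o1 - o2 = o4 - o3 by rewrite /o1 /o2 /o3 /o4 /orient; ring.
(* [orient p q] is affine along the segment from [p'] to [q'], going from [o1] to [o2], so it
   vanishes at parameter [o1 / (o1 - o2)]. Likewise [orient p' q'] vanishes on [p q] at
   [- o3 / (o4 - o3)], whose denominator is the same by [eq_d]. *)
exists ((1 - o1 / (o1 - o2)) *: p' + (o1 / (o1 - o2)) *: q'); split.
- exists (- o3 / (o1 - o2)); split.
  + by apply: divr_gt0 => //; lra.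
  + by rewrite ltr_pdivrMr // mul1r; lra.
  + have dn0 : o1 - o2 != 0 by rewrite gt_eqF.
    apply/rowP => i; rewrite !mxE.
    have [-> | ->] : i = 0 \/ i = 1.
      by case: i => [[|[|//]]] ?; [left | right]; apply: val_inj.
    * move: dn0; rewrite /o1 /o2 /o3 /orient => dn0; field; exact: dn0.
    * move: dn0; rewrite /o1 /o2 /o3 /orient => dn0; field; exact: dn0.
- exists (o1 / (o1 - o2)); split=> //.
  + exact: divr_gt0.
  + by rewrite ltr_pdivrMr // mul1r; lra.
Qed.

Lemma clockwise_cross (a b c d : 'I_N) : clockwise v ->
  (a < c)%N -> (c < b)%N -> (b < d)%N ->
  segments_cross (v a) (v b) (v c) (v d).
Proof.
move=> cw ac cb bd.
(* The four increasing triples of [a < c < b < d] give the four required signs, after permuting the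
   arguments of [orient]. *)
have := cw _ _ _ ac cb; have := cw _ _ _ cb bd.
have := cw _ _ _ ac (ltn_trans cb bd); have := cw _ _ _ (ltn_trans ac cb) bd.
rewrite /orient => h1 h2 h3 h4.
by apply: segments_cross_orient; rewrite /orient; lra.
Qed.

End Crossing.

Definition noncrossing (N : nat) (M : {set {set 'I_N}}) : Prop :=
  forall a b c d : 'I_N, [set a; b] \in M -> [set c; d] \in M ->
    a < c -> c < b -> b < d -> False.

Lemma plane_noncrossing (R : realType) (N : nat) (v : 'I_N -> 'rV[R]_2) M :
  clockwise v -> plane v M -> noncrossing M.
Proof.
move=> cw pl a b c d ab cd ac cb bd.
apply: (pl a b c d ab cd _ (clockwise_cross cw ac cb bd)) => /setP/(_ c).
by rewrite !inE eqxx /= -!val_eqE /= gtn_eqF // ltn_eqF.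
Qed.

(** [A] is the disjoint union of [B], the elements smaller than their image, and [f @: B], which has
    the same size. *)
Lemma even_card_involution (N : nat) (A : {set 'I_N}) (f : 'I_N -> 'I_N) :
  involutive f -> (forall x, f x != x) -> (forall x, x \in A -> f x \in A) ->
  ~~ odd #|A|.
Proof.
move=> fK f_neq fA; set B := [set x : 'I_N in A | x < f x].
have -> : A = B :|: f @: B.
  apply/setP=> x; rewrite !inE; apply/idP/orP.
  - move=> Ax; rewrite Ax /=; case: (ltngtP x (f x)) => [|lt|/val_inj eq].
    + by left.
    + by right; apply/imsetP; exists (f x); rewrite ?inE ?fA // fK.
    + by have := f_neq x; rewrite -eq eqxx.
  - by case=> [/andP[] // | /imsetP[y]]; rewrite inE => /andP[Ay _] ->; apply: fA.
rewrite cardsU disjoint_setI0 ?cards0 ?subn0.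
  by rewrite card_imset ?addnn ?odd_double //; apply: inv_inj.
apply/pred0P=> x /=; apply/negP=> /andP[].
rewrite inE => /andP[_ lt1] /imsetP[y]; rewrite inE => /andP[_ lt2] eq.
by move: lt1 lt2; rewrite eq fK; lia.
Qed.

(** * Partners in a non-crossing perfect matching *)

Section Matching.
Variables (N : nat) (M : {set {set 'I_N}}).
Hypothesis pmM : perfect_matching M.

Lemma matching_irrefl (a b : 'I_N) : [set a; b] \in M -> b != a.
Proof.
by move=> /(proj1 pmM); rewrite cards2 eq_sym; case: eqP.
Qed.

Lemma matching_uniq (a b c : 'I_N) :
  [set a; b] \in M -> [set a; c] \in M -> b = c.
Proof.
move=> ab ac; have/eqP/cards1P[e De] := proj2 pmM a.
have : [set a; b] \in [set e in M | a \in e] by rewrite !inE ab eqxx.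
have : [set a; c] \in [set e in M | a \in e] by rewrite !inE ac eqxx.
rewrite De !inE => /eqP <- /eqP/setP/(_ b).
rewrite !inE eqxx orbT (negPf (matching_irrefl ab)) /=.
by move=> /esym/eqP.
Qed.

Lemma matching_exists (a : 'I_N) : exists b, [set a; b] \in M.
Proof.
have/eqP/cards1P[e De] := proj2 pmM a.
have : e \in [set e in M | a \in e] by rewrite De set11.
rewrite inE => /andP[eM ae].
have/eqP/cards2P[x [y [xy ee]]] := proj1 pmM _ eM.
move: ae eM; rewrite ee !inE => /orP[]/eqP-> ?; first by exists y.
by exists x; rewrite setUC.
Qed.

Definition partner (a : 'I_N) : 'I_N := xchoose (matching_exists a).

Lemma partner_edge a : [set a; partner a] \in M.
Proof. exact: (xchooseP (matching_exists a)). Qed.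

Lemma partner_eq a b : [set a; b] \in M -> partner a = b.
Proof. exact: matching_uniq (partner_edge a). Qed.

Lemma partnerK : involutive partner.
Proof. by move=> a; apply: partner_eq; rewrite setUC partner_edge. Qed.

Lemma partner_neq a : partner a != a.
Proof. exact: matching_irrefl (partner_edge a). Qed.

Lemma outdegree_partner a : outdegree M a = (a < partner a).
Proof.
rewrite /outdegree.
have -> : [set b : 'I_N | (a < b) && ([set a; b] \in M)]
        = if a < partner a then [set partner a] else set0.
  apply/setP=> b; rewrite !inE; apply/andP/idP => [[ab /partner_eq pa] | ].
    by rewrite pa ab set11.
  by case: ifP => [lt|]; rewrite !inE // => /eqP ->; rewrite lt partner_edge.
by case: ifP => _; rewrite ?cards1 ?cards0.
Qed.

Hypothesis ncM : noncrossing M.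

(** Otherwise the edge at [x] would cross the edge at [s] or share an endpoint with it. *)
Lemma partner_between (s x : 'I_N) :
  s < x -> x < partner s -> s < partner x < partner s.
Proof.
move=> sx xe; have := partner_edge x; have := partner_edge s.
case: (ltngtP (partner x) s) => [lt|gt|/val_inj eq].
- by rewrite [[set x; _]]setUC => h1 h2; case: (ncM h2 h1).
- case: (ltngtP (partner x) (partner s)) => [//|lt h1 h2|/val_inj eq].
    by case: (ncM h1 h2).
  by move: sx; rewrite (can_inj partnerK eq) ltnn.
- by move: xe; rewrite -eq partnerK ltnn.
Qed.

End Matching.

(** * Color counts in initial segments and in intervals *)

Section Colors.
Variable k : nat.
Hypothesis k_gt0 : 0 < k.

(* Being an involution in [c], this is both the color at position [c] of block
[b] and the position of color [c] in it. *)
Definition color_pos (b c : nat) : nat := if odd b then k.-1 - c else c.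

Lemma colorE a : color k a = color_pos (block k a) (pos k a).
Proof. by []. Qed.

Lemma pos_lt a : pos k a < k.
Proof. exact: ltn_pmod. Qed.

Lemma color_posK b c : c < k -> color_pos b (color_pos b c) = c.
Proof. by rewrite /color_pos; case: (odd b); lia. Qed.

Lemma color_lt a : color k a < k.
Proof. by have := pos_lt a; rewrite /color; case: ifP; lia. Qed.

Lemma color_eqE a c : c < k ->
  (color k a == c) = (pos k a == color_pos (block k a) c).
Proof.
move=> ck; rewrite colorE; apply/eqP/eqP => [<- | ->]; rewrite color_posK //.
exact: pos_lt.
Qed.

Lemma color_block_inj a b :
  block k a = block k b -> color k a = color k b -> a = b.
Proof.
move=> eq_bl /eqP; rewrite color_eqE ?color_lt // colorE eq_bl color_posK ?pos_lt //.
by move=> /eqP eq_pos; rewrite (divn_eq a k) (divn_eq b k) -/(block k a) eq_bl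
  -/(pos k a) eq_pos.
Qed.

Lemma block_posS a : (block k a.+1 = block k a /\ pos k a.+1 = (pos k a).+1)
  \/ [/\ block k a.+1 = (block k a).+1, pos k a.+1 = 0 & (pos k a).+1 = k].
Proof.
have := pos_lt a; have := divn_eq a k; rewrite -/(block k a) -/(pos k a).
move=> Da; rewrite leq_eqVlt => /orP[/eqP eqk | ltk].
- have Da1 : a.+1 = (block k a).+1 * k by rewrite {1}Da -addnS eqk mulSnr.
  by right; split; rewrite ?/(block k a.+1) ?/(pos k a.+1) ?Da1 ?mulnK ?modnMl.
- have Da1 : a.+1 = block k a * k + (pos k a).+1 by rewrite addnS -Da.
  left; rewrite /(block k a.+1) /(pos k a.+1) Da1 divnMDl // modnMDl.
  by rewrite divn_small // modn_small // addn0.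
Qed.

(** Each full block contains [c] once; the block of [x] contributes only if the position of [c] in
    it comes before [x]. *)
Lemma count_color c x : c < k ->
  \sum_(0 <= y < x) (color k y == c)
  = block k x + (color_pos (block k x) c < pos k x).
Proof.
move=> ck; elim: x => [|x IHx].
  by rewrite big_geq // /block /pos div0n mod0n ltn0.
rewrite big_nat_recr //= IHx color_eqE //.
have cp_lt : color_pos (block k x) c < k by rewrite /color_pos; case: ifP; lia.
case: (block_posS x) => [[-> ->] | [-> -> ek]]; rewrite -addnA ?ltn0; first lia.
by have := cp_lt; lia.
Qed.

(** This is the difference of two prefix counts modulo 2. Discarding [s] itself as well turns the
    strict comparison at [s] into [<=]. *)
Lemma odd_count_color_between c s e : c < k -> s < e ->
  odd (\sum_(s.+1 <= y < e) (color k y == c)) =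
  odd (block k s) (+) odd (block k e) (+)
  ((color_pos (block k s) c <= pos k s) (+) (color_pos (block k e) c < pos k e)).
Proof.
move=> ck se; have := count_color e ck; have := count_color s ck.
rewrite (@big_cat_nat _ _ addn s.+1 0 e) //= big_nat_recr //= => ->.
move/(congr1 odd); rewrite !oddD color_eqE // !oddb.
rewrite (leq_eqVlt (color_pos _ _)) (eq_sym (pos k s)).
case: (ltngtP (color_pos (block k s) c) (pos k s)) => _ /=;
by case: (odd (block k s)); case: (odd (block k e)); case: (odd (bigop _ _ _));
  case: (_ < pos k e).
Qed.

Lemma pos_of_even_counts s e : s < e ->
  (forall c, c < k -> ~~ odd (\sum_(s.+1 <= y < e) (color k y == c))) ->
  if odd (block k s) (+) odd (block k e) then color k s = color k e
  else pos k e = (pos k s).+1.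
Proof.
move=> se ev.
(* Colors are indexed by their position [p] in the block of [s]; in the block of [e] that position
   is [p] again or its mirror image, depending on the parities. *)
have par p : p < k -> ~~ (odd (block k s) (+) odd (block k e) (+)
    ((p <= pos k s) (+) (color_pos (block k e) (color_pos (block k s) p) < pos k e))).
  move=> pk; have cp : color_pos (block k s) p < k by rewrite /color_pos; case: ifP; lia.
  by have := ev _ cp; rewrite odd_count_color_between // color_posK.
have := par (pos k s); have := par (pos k s).+1.
have := pos_lt s; have := pos_lt e.
rewrite /color /color_pos.
by case: (odd (block k s)); case: (odd (block k e)) => /=; lia.
Qed.

Lemma blocks_betweenE N (s e : 'I_N) :
  blocks_between k s e = block k e - (block k s).+1.
Proof.
(* Hence the bound [N %/ k] on block numbers cuts off no block before that of [e]. *)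
have le_e : block k e <= N %/ k by apply/leq_div2r/ltnW.
rewrite /blocks_between -[RHS]muln1 -sum_nat_const_nat (big_nat_widenl _ 0) //.
rewrite (big_nat_widen _ _ (N %/ k)) // big_mkord sum1_card cardsE.
by apply: eq_card.
Qed.

End Colors.

(** * The two directions of the equivalence *)

Section Characterization.
Variables (k N : nat) (M : {set {set 'I_N}}).
Hypotheses (k_gt0 : 0 < k) (pmM : perfect_matching M) (ncM : noncrossing M).

(** A color occurs once per block, so every edge leaves its block. If [a < b] violated validity,
    then [partner b < a < b < partner a] would be a crossing. *)
Lemma colored_valid : colored_matching k M -> valid_block_structure k M.
Proof.
move=> colM a b eq_bl; rewrite !(outdegree_partner pmM) => oa ob ab.
have block_neq x : block k (partner pmM x) <> block k x.
  move=> /(color_block_inj k_gt0) eqx; have := partner_neq pmM x.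
  by rewrite -val_eqE /= eqx ?eqxx //; apply/esym/colM/partner_edge.
have ltbl x y : block k x < block k y -> x < y.
  by apply: contraTltn => /(leq_div2r k); rewrite -leqNgt.
have pa : a < partner pmM a by lia.
have pb : partner pmM b < b.
  by have := partner_neq pmM b; rewrite -val_eqE /=; lia.
have := partner_edge pmM b; rewrite setUC => eb.
apply: (ncM eb (partner_edge pmM a)) => //; apply: ltbl.
- by have := block_neq b; have := leq_div2r k (ltnW pb); rewrite /block in eq_bl *; lia.
- by have := block_neq a; have := leq_div2r k (ltnW pa); rewrite /block in eq_bl *; lia.
Qed.

(** An odd number of blocks in between gives both blocks the same parity, hence the same color
    order, so equal colors force equal positions. *)
Lemma colored_no_forbidden (s e : 'I_N) : colored_matching k M ->
  s < e -> [set s; e] \in M -> ~ forbidden_edge k M s e.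
Proof.
move=> colM se /colM eq_col [bl_neq _]; rewrite blocks_betweenE // => odd_bl eq_pos.
have bl_le : block k s <= block k e by apply/leq_div2r/ltnW.
have := pos_lt k_gt0 s; have := pos_lt k_gt0 e; move: eq_col; rewrite /color.
have -> : odd (block k e) = odd (block k s) by lia.
by case: ifP; lia.
Qed.

(** The partner map restricts to an involution without fixed points on the vertices of color [c]
    inside the edge. *)
Lemma even_color_count_inside (s e : 'I_N) c : [set s; e] \in M ->
  (forall a b : 'I_N, [set a; b] \in M -> s < a < e -> s < b < e ->
     color k a = color k b) ->
  ~~ odd (\sum_(s.+1 <= y < e) (color k y == c)).
Proof.
move=> se mono; have De := partner_eq pmM se.
suff -> : \sum_(s.+1 <= y < e) (color k y == c)
        = #|[set y : 'I_N | (s < y < e) && (color k y == c)]|.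
  apply: (even_card_involution (partnerK pmM) (partner_neq pmM)) => x.
  rewrite !inE -De => /andP[/andP[sx xe] /eqP <-].
  have btw := partner_between ncM sx xe; rewrite btw /=; apply/eqP/esym.
  by apply: (mono _ _ (partner_edge pmM x)); rewrite -De ?sx.
rewrite -sum1_card (big_nat_widenl _ 0) // (big_nat_widen _ _ N) ?(ltnW (ltn_ord e)) //.
rewrite big_mkord -big_mkcondr /=.
by apply: eq_bigl => y; rewrite !inE; case: (_ == c); rewrite ?andbT ?andbF.
Qed.

Lemma valid_unforbidden_colored : valid_block_structure k M ->
  ~ (exists s e : 'I_N, [/\ s < e, [set s; e] \in M & forbidden_edge k M s e]) ->
  colored_matching k M.
Proof.
move=> validM nforb.
(* Induction on the bound [m] for the length [e - s] plays the role of choosing a shortest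
   bichromatic edge. *)
suff main m (s e : 'I_N) : e - s < m -> s < e -> [set s; e] \in M -> color k s = color k e.
  move=> a b ab; case: (ltngtP a b) => [lt|lt|/val_inj -> //].
    exact: main (ltnSn _) lt ab.
  by apply/esym/(main _ _ _ (ltnSn _) lt); rewrite setUC.
elim: m s e => [//|m IHm] s e lt_m se seM.
have mono (a b : 'I_N) : [set a; b] \in M -> s < a < e -> s < b < e ->
    color k a = color k b.
  move=> ab sa sb; case: (ltngtP a b) => [lt|lt|/val_inj -> //].
    by apply: IHm => //; lia.
  by apply/esym/IHm; [lia | | rewrite setUC].
(* Inside one block, [s] with outdegree 1 would precede [e] with outdegree 0. *)
have bl_neq : block k s <> block k e.
  move=> eq_bl; apply: (validM s e eq_bl _ _ se); rewrite (outdegree_partner pmM).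
    by rewrite (partner_eq pmM seM) se.
  rewrite setUC in seM; by rewrite (partner_eq pmM seM) ltnNge (ltnW se).
have bl_le : block k s <= block k e by apply/leq_div2r/ltnW.
have := pos_of_even_counts k_gt0 se
  (fun c _ => even_color_count_inside c seM mono).
(* Blocks of opposite parity give equal colors at once. Otherwise the edge is forbidden: distinct
   blocks of equal parity have an odd number of blocks between them. *)
case: ifP => // par eq_pos; case: nforb; exists s, e; split=> //; split=> //.
- by case=> a [b [ab neq sa sb]]; apply/neq/mono.
- by rewrite blocks_betweenE //; lia.
Qed.

End Characterization.

Theorem theorem2 (R : realType) (k n : nat) (hk : 2 <= k) (hn : 0 < n)
  (hkn : k %| n) (v : 'I_(2 * n) -> 'rV[R]_2)
  (hconv : convex_position v) (hclock : clockwise v)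
  (M : {set {set 'I_(2 * n)}}) (hM : plane_perfect_matching v M) :
  colored_matching k M <->
  (valid_block_structure k M /\
   ~ (exists s e : 'I_(2 * n),
        [/\ s < e, [set s; e] \in M & forbidden_edge k M s e])).
Proof.
have k_gt0 : 0 < k := ltnW hk.
have [pmM plM] := hM; have ncM := plane_noncrossing hclock plM.
split=> [colM | [validM nforb]]; last exact: valid_unforbidden_colored.
split; first exact: colored_valid.
by case=> s [e [se seM]]; apply: colored_no_forbidden.
Qed.
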